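(* Let $B$ be an arbitrary language over a finite ordered alphabet $\Gamma$, and let $A \subseteq \Delta^*$ be a language describable by a sentence of the form $Q_B x\,[\phi_1(x),\dots,\phi_{|\Gamma|-1}(x)]$, where the $\phi_i$ are first-order formulas (with linear order, without BIT) and $Q_B$ is the unary Lindström quantifier given by $B$ (binding exactly the one variable $x$). Then there exist length-preserving homomorphisms $g,h$ and a regular language $D$ such that $A = h(D \cap g^{-1}(B))$.
   Context: Words $w=w_1\cdots w_n$ over a finite ordered alphabet $\Delta$ are viewed as finite structures with universe $\{1,\dots,n\}$, unary predicates $P_a$ for $a\in\Delta$ ($P_a(j)$ holds iff $w_j=a$), the linear order $<$, equality, and constants min, max; first-order (FO) formulas are built over this signature. Lindström quantifier: for a language $L$ over an ordered alphabet $(b_1,\dots,b_t)$, a $k$-tuple of variables $\bar x$, and formulas $\phi_1(\bar x),\dots,\phi_{t-1}(\bar x)$, the formula $Q_L\bar x[\phi_1,\dots,\phi_{t-1}]$ holds on a word $w$ of length $n$ iff the word of length $n^k$ whose $i$th letter ($X_1,\dots,X_{n^k}$ being the $k$-tuples over $\{1,\dots,n\}$ in lexicographic order) is $b_j$ for the least $j\le t-1$ with $w\models\phi_j(X_i)$, and $b_t$ if there is no such $j$, belongs to $L$. The quantifier is unary if $k=1$. A homomorphism $\Sigma^*\to\Delta^*$ is length-preserving if it maps each letter to a letter. *)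

(* Defs.v *)
From mathcomp Require Import all_boot all_order.
From mathcomp Require Export classical_sets.

Set Implicit Arguments.
Unset Strict Implicit.
Unset Printing Implicit Defensive.

Import Order.TTheory.
Local Open Scope classical_set_scope.

(* [formula Delta k]: first-order formulas over words in the alphabet Delta
   whose free variables are among x_0, ..., x_(k-1). Variables are well-scoped
   de Bruijn indices: under a quantifier, index 0 is the bound variable and
   every outer index is shifted by one. *)
Inductive term (k : nat) : Type :=
| Var of 'I_k
| Min
| Max.

Arguments Min {k}.
Arguments Max {k}.

Inductive formula (Delta : Type) : nat -> Type :=
| Letter k of Delta & term k : formula Delta k
| Less k of term k & term k : formula Delta k
| Equal k of term k & term k : formula Delta k
| Not k of formula Delta k : formula Delta k
| And k of formula Delta k & formula Delta k : formula Delta k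
| Or k of formula Delta k & formula Delta k : formula Delta k
| Exists k of formula Delta k.+1 : formula Delta k
| Forall k of formula Delta k.+1 : formula Delta k.

Arguments Less {Delta k}.
Arguments Equal {Delta k}.

(* The universe of a word w is 'I_(size w), i.e. positions are numbered from 0,
   so that min is 0 and max is (size w).-1. Terms are evaluated in nat since
   'I_(size w) is empty for the empty word; on a nonempty word the value is
   always a position of w. *)
Definition eval_term n k (e : k.-tuple 'I_n) (t : term k) : nat :=
  match t with
  | Var i => tnth e i
  | Min => 0
  | Max => n.-1
  end.

Fixpoint sat (Delta : eqType) (w : seq Delta) k (phi : formula Delta k) :
    k.-tuple 'I_(size w) -> bool :=
  match phi in formula _ k return k.-tuple 'I_(size w) -> bool with
  | Letter _ a t => fun e => onth w (eval_term e t) == Some a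
  | Less _ s t => fun e => eval_term e s < eval_term e t
  | Equal _ s t => fun e => eval_term e s == eval_term e t
  | Not _ psi => fun e => ~~ sat psi e
  | And _ psi1 psi2 => fun e => sat psi1 e && sat psi2 e
  | Or _ psi1 psi2 => fun e => sat psi1 e || sat psi2 e
  | Exists _ psi => fun e => [exists p, sat psi [tuple of p :: e]]
  | Forall _ psi => fun e => [forall p, sat psi [tuple of p :: e]]
  end.

(* A finite ordered alphabet (b_1, ..., b_t), t >= 1, is a finTBOrderType
   (a nonempty finite total order), b_1 < ... < b_t being its elements in
   increasing order. [find] returns the index of the first formula that holds,
   and t - 1 if there is none, in which case the letter is b_t. *)
Definition lindstrom_letter (Delta : eqType) d (Gamma : finTBOrderType d)
    (phi : #|Gamma|.-1.-tuple (formula Delta 1)) (w : seq Delta)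
    (i : 'I_(size w)) : Gamma :=
  nth Order.top (sort <=%O (enum Gamma))
    (find (fun psi => sat psi [tuple i]) phi).

(* w |= Q_B x [phi_1(x), ..., phi_(t-1)(x)] *)
Definition sat_lindstrom (Delta : eqType) d (Gamma : finTBOrderType d)
    (B : set (seq Gamma)) (phi : #|Gamma|.-1.-tuple (formula Delta 1))
    (w : seq Delta) : Prop :=
  B [seq lindstrom_letter phi i | i <- enum 'I_(size w)].

Record dfa (Sigma : finType) : Type := DFA {
  dfa_state : finType;
  dfa_init : dfa_state;
  dfa_final : {set dfa_state};
  dfa_step : dfa_state -> Sigma -> dfa_state
}.

Definition dfa_accept (Sigma : finType) (M : dfa Sigma) (w : seq Sigma) : bool :=
  foldl (@dfa_step Sigma M) (dfa_init M) w \in dfa_final M.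

Definition regular (Sigma : finType) (D : set (seq Sigma)) : Prop :=
  exists M : dfa Sigma, D = [set w | dfa_accept M w].

Definition length_preserving_hom (S T : Type) (f : seq S -> seq T) : Prop :=
  [/\ f [::] = [::],
      {morph f : u v / u ++ v}
    & forall a : S, exists b : T, f [:: a] = [:: b]].

(* Main.v *)
(** Take [Sigma := Delta * Gamma], with [h] and [g] the two projections, and let
    [D] be the set of words whose [Gamma]-track is the word that the formulas
    [phi] define on the [Delta]-track. That [D] is regular is the easy half of
    Büchi's theorem: a predicate of a word and [k] of its positions is tested by
    an automaton reading the word with [k] additional tracks of marks, and an
    existential quantifier is removed by a subset construction. *)
Require Import Defs.
From mathcomp Require Import all_boot all_order classical_sets.
From mathcomp Require Import zify.
Set Implicit Arguments.
Unset Strict Implicit.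
Unset Printing Implicit Defensive.

Local Notation run M := (foldl (@dfa_step _ M)).

(** * Predicates recognised on words with marked positions *)

Section Recognizable.
Variable S : finType.
Implicit Types (w : seq S) (k n : nat).

(** [n] is the position of the first letter of [w] in the whole word, so the entries of [e] stay
    absolute when a recursion or induction passes to a suffix. *)
Fixpoint marked k n w (e : k.-tuple nat) : seq (S * k.-tuple bool) :=
  if w is a :: w' then (a, [tuple of map (eq_op n) e]) :: marked n.+1 w' e
  else [::].

(** Nothing is asked of [M] on words where some track does not carry exactly one mark, so negation
    only complements the acceptance condition. *)
Definition recognizable k (P : seq S -> k.-tuple nat -> bool) :=
  exists M : dfa (S * k.-tuple bool)%type,
    forall w (e : k.-tuple nat),
      all (gtn (size w)) e -> dfa_accept M (marked 0 w e) = P w e.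

(** * Closure under Boolean operations and projection *)

Lemma eq_recognizable k (P Q : seq S -> k.-tuple nat -> bool) :
  (forall w (e : k.-tuple nat), all (gtn (size w)) e -> P w e = Q w e) ->
  recognizable P -> recognizable Q.
Proof.
by move=> PQ [M MP]; exists M => w e le_e; rewrite MP // PQ.
Qed.

Lemma recognizable_op (op : bool -> bool -> bool) k
    (P Q : seq S -> k.-tuple nat -> bool) :
  recognizable P -> recognizable Q ->
  recognizable (fun w e => op (P w e) (Q w e)).
Proof.
move=> [M MP] [N NQ].
pose step (q : dfa_state M * dfa_state N) x :=
  (dfa_step q.1 x, dfa_step q.2 x).
exists (DFA (dfa_init M, dfa_init N)
  [set q | op (q.1 \in dfa_final M) (q.2 \in dfa_final N)] step) => w e le_e.
have runE v q : foldl step q v = (run M q.1 v, run N q.2 v).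
  by elim: v q => [|x v IHv] [q1 q2] //=; rewrite IHv.
by rewrite -MP // -NQ // /dfa_accept /= runE inE.
Qed.

Lemma recognizable_not k (P : seq S -> k.-tuple nat -> bool) :
  recognizable P -> recognizable (fun w e => ~~ P w e).
Proof. by move=> rP; apply: (recognizable_op (fun b _ => ~~ b) rP rP). Qed.

Definition unmark k (x : S * k.-tuple bool) : S * k.+1.-tuple bool :=
  (x.1, [tuple of false :: x.2]).

Lemma marked_unmark k n w p (e : k.-tuple nat) : p < n ->
  marked n w [tuple of p :: e] = map (@unmark k) (marked n w e).
Proof.
elim: w n => [|a w IHw] n //= lt_pn; rewrite IHw ?leqW //.
congr (_ :: _); congr (_, _); apply: val_inj => /=.
by rewrite gtn_eqF.
Qed.

(* The state [(q, T)] holds the state [q] of [M] when the new track has no mark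
   so far, and the set [T] of those that M can have when it has one. *)
Lemma recognizable_exists k (P : seq S -> k.+1.-tuple nat -> bool) :
  recognizable P ->
  recognizable
    (fun w e => has (fun p => P w [tuple of p :: e]) (iota 0 (size w))).
Proof.
move=> [M MP].
pose step (q : dfa_state M * {set dfa_state M}) (x : S * k.-tuple bool) :=
  (dfa_step q.1 (unmark x),
   dfa_step q.1 (x.1, [tuple of true :: x.2])
     |: [set dfa_step s (unmark x) | s in q.2]).
pose final (q : dfa_state M * {set dfa_state M}) :=
  [exists s in q.2, s \in dfa_final M].
exists (DFA (dfa_init M, finset.set0) [set q | final q] step) => w e le_e.
(* The new mark either has been read already, which the states in [T] account for, or is still to
   come at a position [p] of the suffix [v], which starts at [n]. *)
have finalE v n q T :
    final (foldl step (q, T) (marked n v e)) =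
    [exists s in T,
       run M s (map (@unmark k) (marked n v e)) \in dfa_final M]
    || has (fun p => run M q (marked n v [tuple of p :: e]) \in dfa_final M)
         (iota n (size v)).
  elim: v n q T => [|a v IHv] n q T /=; first by rewrite orbF.
  rewrite IHv /= orbA; congr (_ || _); last first.
    apply: eq_in_has => p; rewrite mem_iota => /andP[lt_np _].
    have -> // : [tuple of map (eq_op n) [tuple of p :: e]]
        = [tuple of false :: [tuple of map (eq_op n) e]].
    by apply: val_inj; rewrite /= ltn_eqF.
  have -> : [tuple of map (eq_op n) [tuple of n :: e]]
      = [tuple of true :: [tuple of map (eq_op n) e]].
    by apply: val_inj; rewrite /= eqxx.
  (* Once the mark at [n] has been read, the rest of the new track is unmarked. *)
  rewrite marked_unmark //.
  apply/existsP/orP => [[s /andP[]] | [/existsP[s /andP[sT Fs]] | Fq]].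
  - rewrite in_setU1 => /orP[/eqP-> | /imsetP[r rT ->]] F; first by right.
    by left; apply/existsP; exists r; rewrite rT.
  - exists (dfa_step s (unmark (a, [tuple of map (eq_op n) e]))).
    by rewrite setU1r ?Fs //; apply: (imset_f (fun r => dfa_step r _)).
  - exists (dfa_step q (a, [tuple of true :: map (eq_op n) e])).
    by rewrite setU11.
rewrite /dfa_accept /= inE finalE /=.
(* The initial [T] is empty, so only marks still to come contribute. *)
case: existsP => [[s] | _]; first by rewrite inE.
apply: eq_in_has => p; rewrite mem_iota add0n => lt_p.
by rewrite -MP //= le_e andbT.
Qed.

(** * Atomic predicates *)

Lemma recognizable_letter (X : pred S) k (i : 'I_k) :
  recognizable (fun w e => oapp X false (onth w (tnth e i))).
Proof.
(* The bit is set when the mark of track [i] is read at a letter in [X]. *)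
pose step s (x : S * k.-tuple bool) := s || tnth x.2 i && X x.1.
exists (DFA false [set true] step) => w e _.
have runE v n s : foldl step s (marked n v e) =
    s || (n <= tnth e i) && oapp X false (onth v (tnth e i - n)).
  elim: v n s => [|a v IHv] n s /=; first by rewrite onth0n andbF orbF.
  rewrite IHv /step /= tnth_map -orbA; congr (_ || _).
  case: ltngtP => [lt_n|//|->] /=; last by rewrite subnn orbF.
  by rewrite -(subnSK lt_n).
by rewrite /dfa_accept /= inE runE subn0 eqb_id.
Qed.

Lemma recognizable_lt k (i j : 'I_k) :
  recognizable (fun w e => tnth e i < tnth e j).
Proof.
(* [s.1]: the mark of [i] has been read; [s.2]: the mark of [j] has been read after it. Updating
   [s.2] from the old [s.1] makes the comparison strict. *)
pose step (s : bool * bool) (x : S * k.-tuple bool) :=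
  (s.1 || tnth x.2 i, s.2 || s.1 && tnth x.2 j).
exists (DFA (false, false) [set s | s.2] step) => w e /all_tnthP le_e.
have runE v n s : (foldl step s (marked n v e)).2 =
    s.2 || (n <= tnth e j < n + size v) && (s.1 || (n <= tnth e i < tnth e j)).
  elim: v n s => [|a v IHv] n [s t] /=; first by lia.
  by rewrite IHv /= !tnth_map; case: s t => [] []; lia.
by rewrite /dfa_accept /= inE runE /=; have /= := le_e j; lia.
Qed.

(** * Terms and substitution *)

Definition term_pos k w (e : k.-tuple nat) (t : term k) : nat :=
  match t with
  | Var i => tnth e i
  | Min => 0
  | Max => (size w).-1
  end.

Definition shift_term k (t : term k) : term k.+1 :=
  match t with Var i => Var (lift ord0 i) | Min => Min | Max => Max end.

Lemma term_pos_shift k w p (e : k.-tuple nat) t :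
  term_pos w [tuple of p :: e] (shift_term t) = term_pos w e t.
Proof. by case: t => //= i; rewrite tnthS. Qed.

Lemma ltn_term_pos k w (e : k.-tuple nat) t :
  all (gtn (size w)) e -> 0 < size w -> term_pos w e t < size w.
Proof.
by move=> /all_tnthP le_e w_gt0; case: t => [i||] //=; [apply: le_e | lia].
Qed.

(** All three cases reduce to the order: two positions are equal when neither is less, the minimum
    has no position below it, the maximum none above it. *)
Lemma recognizable_eq_term k (j : 'I_k) (t : term k) :
  recognizable (fun w e => tnth e j == term_pos w e t).
Proof.
case: t => [i||].
- apply: eq_recognizable (recognizable_op (fun b c => ~~ (b || c))
    (recognizable_lt i j) (recognizable_lt j i)) => w e _ /=.
  by lia.
- apply: eq_recognizable (recognizable_not (recognizable_exists
    (recognizable_lt ord0 (lift ord0 j)))) => w e /all_tnthP/(_ j) /= lt_j.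
  rewrite -all_predC -leqn0; apply/allP/idP => [/(_ 0) | j0 p _] /=.
    by rewrite mem_iota tnth0 tnthS; lia.
  by rewrite tnth0 tnthS; lia.
- apply: eq_recognizable (recognizable_not (recognizable_exists
    (recognizable_lt (lift ord0 j) ord0))) => w e /all_tnthP/(_ j) /= lt_j.
  rewrite -all_predC; apply/allP/eqP => [/(_ (size w).-1) | j0 p] /=.
    by rewrite mem_iota tnth0 tnthS; lia.
  by rewrite mem_iota tnth0 tnthS; lia.
Qed.

(** [P] holds at [t] iff some position equals [t] and satisfies [P]. The conjunct [0 < size w]
    accounts for the empty word, which has no such position although [Min] and [Max] still evaluate
    to 0. *)
Lemma recognizable_subst k (P : seq S -> k.+1.-tuple nat -> bool) (t : term k) :
  recognizable P ->
  recognizable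
    (fun w e => (0 < size w) && P w [tuple of term_pos w e t :: e]).
Proof.
move=> rP; apply: eq_recognizable (recognizable_exists (recognizable_op andb
  (recognizable_eq_term ord0 (shift_term t)) rP)) => w e le_e /=.
apply/hasP/andP => [[p] | [w_gt0 Pt]].
  rewrite mem_iota tnth0 term_pos_shift => lt_p /andP[/eqP<- ->].
  by split=> //; lia.
exists (term_pos w e t); first by rewrite mem_iota /= ltn_term_pos.
by rewrite tnth0 term_pos_shift eqxx.
Qed.

(** Two substitutions into the order on variables: [lt_var] treats the right-hand term, then [s] is
    substituted on the left. *)
Lemma recognizable_lt_term k (s t : term k) :
  recognizable (fun w e => (0 < size w) && (term_pos w e s < term_pos w e t)).
Proof.
have lt_var l (i : 'I_l) (r : term l) :
    recognizable (fun w e => (0 < size w) && (tnth e i < term_pos w e r)).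
  apply: eq_recognizable
    (recognizable_subst r (recognizable_lt (lift ord0 i) ord0)) => w e _.
  by rewrite tnth0 tnthS.
apply: eq_recognizable
  (recognizable_subst s (lt_var _ ord0 (shift_term t))) => w e _.
by rewrite tnth0 term_pos_shift; case: (0 < size w).
Qed.

Lemma recognizable_regular (P : seq S -> 0.-tuple nat -> bool) :
  recognizable P -> regular [set w | P w [tuple]]%classic.
Proof.
move=> [M MP].
pose step q a := dfa_step (d := M) q (a, [tuple]).
exists (DFA (dfa_init M) (dfa_final M) step).
have runE v n q : foldl step q v = run M q (marked n v [tuple]).
  elim: v n q => [|a v IHv] n q //=; rewrite (IHv n.+1).
  by have -> : [tuple of map (eq_op n) [tuple]] = [tuple] by exact: val_inj.
by apply/seteqP; split=> w /=; rewrite -MP // /dfa_accept /= (runE w 0).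
Qed.

End Recognizable.

(** * Change of alphabet *)

Lemma marked_map (S T : finType) (f : S -> T) k n w (e : k.-tuple nat) :
  marked n (map f w) e = [seq (f x.1, x.2) | x <- marked n w e].
Proof. by elim: w n => //= a w IHw n; rewrite IHw. Qed.

(** The automaton applies [f] to each letter as it reads. With [f] a projection, formulas over one
    track can be tested on words of pairs. *)
Lemma recognizable_map (S T : finType) (f : S -> T) k
    (P : seq T -> k.-tuple nat -> bool) :
  recognizable P -> recognizable (fun w e => P (map f w) e).
Proof.
move=> [M MP].
pose step q x := dfa_step (d := M) q (f x.1, x.2).
exists (DFA (dfa_init M) (dfa_final M) step) => w e le_e.
have runE v q : foldl step q v = run M q [seq (f x.1, x.2) | x <- v].
  by elim: v q => //= x v IHv q.
by rewrite -MP ?size_map // /dfa_accept marked_map /= runE.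
Qed.

(** * First-order formulas *)

Definition pos_tuple n k (e : k.-tuple 'I_n) : k.-tuple nat :=
  [tuple of map val e].

Lemma pos_tuple_cons n k (p : 'I_n) (e : k.-tuple 'I_n) :
  pos_tuple [tuple of p :: e] = [tuple of val p :: pos_tuple e].
Proof. exact: val_inj. Qed.

Lemma gtn_pos_tuple n k (e : k.-tuple 'I_n) : all (gtn n) (pos_tuple e).
Proof. by apply/allP => _ /mapP[p _ ->] /=. Qed.

Lemma term_pos_eval (S : finType) (w : seq S) k (e : k.-tuple 'I_(size w)) t :
  term_pos w (pos_tuple e) t = eval_term e t.
Proof. by case: t => //= i; rewrite tnth_map. Qed.

Lemma has_iota_exists n (P : pred nat) :
  has P (iota 0 n) = [exists p : 'I_n, P p].
Proof.
rewrite -val_enum_ord has_map.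
by apply/hasP/existsP => [[p _] | [p]] Pp; exists p; rewrite ?mem_enum.
Qed.

Lemma eval_term_nil (S : finType) (w : seq S) k (e : k.-tuple 'I_(size w)) t :
  size w = 0 -> eval_term e t = 0.
Proof.
by move=> w0; case: t => [i||] //=; [case: (tnth e i) => m /= |]; rewrite w0.
Qed.

(** [sat] takes positions whose type depends on the word, so [recognizable] does not apply to it
    directly; the induction builds a predicate on natural numbers that agrees with it. *)
Lemma sat_recognizable (Delta : finType) k (phi : formula Delta k) :
  exists2 P : seq Delta -> k.-tuple nat -> bool, recognizable P
    & forall w (e : k.-tuple 'I_(size w)), P w (pos_tuple e) = sat phi e.
Proof.
elim: phi => {k} [k a t|k s t|k s t|k psi [P rP PE]|k psi1 [P rP PE] psi2
  [Q rQ QE]|k psi1 [P rP PE] psi2 [Q rQ QE]|k psi [P rP PE]|k psi [P rP PE]].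
- eexists; first exact: (recognizable_subst t
    (recognizable_letter (pred1 a) ord0)).
  move=> w e /=; rewrite tnth0 term_pos_eval.
  by case: w e => [|b w] e /=; [rewrite onth0n | case: onth].
- eexists; first exact: (recognizable_lt_term _ s t).
  move=> w e /=; rewrite !term_pos_eval.
  by case: posnP => //= w0; rewrite !eval_term_nil.
(* Equality is the failure of both strict comparisons. This covers the empty word too: both guarded
   comparisons fail there, and both terms are 0. *)
- eexists; first exact: (recognizable_op (fun b c => ~~ (b || c))
    (recognizable_lt_term _ s t) (recognizable_lt_term _ t s)).
  move=> w e /=; rewrite !term_pos_eval.
  case: posnP => /= [w0|_]; first by rewrite !eval_term_nil.
  by lia.
- by eexists; [exact: (recognizable_not rP) | move=> w e /=; rewrite PE].
- eexists; first exact: (recognizable_op andb rP rQ).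
  by move=> w e /=; rewrite PE QE.
- eexists; first exact: (recognizable_op orb rP rQ).
  by move=> w e /=; rewrite PE QE.
- eexists; first exact: (recognizable_exists rP).
  move=> w e /=; rewrite has_iota_exists; apply: eq_existsb => p.
  by rewrite -PE pos_tuple_cons.
- eexists.
    exact: (recognizable_not (recognizable_exists (recognizable_not rP))).
  move=> w e /=; rewrite has_iota_exists negb_exists; apply: eq_forallb => p.
  by rewrite negbK -PE pos_tuple_cons.
Qed.

Lemma find_recognizable (S Delta : finType) (f : S -> Delta)
    (phi : seq (formula Delta 1)) (F : nat -> pred S) :
  exists2 P : seq S -> 1.-tuple nat -> bool, recognizable P
    & forall (u : seq S) (i : 'I_(size (map f u))),
      P u [tuple val i] =
      oapp (F (find (fun psi => sat psi [tuple i]) phi)) false (onth u i).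
Proof.
elim: phi F => [|psi phi IHphi] F /=.
  by eexists; first exact: (recognizable_letter (F 0) ord0).
have [Q rQ QE] := IHphi (fun n => F n.+1).
have [P rP PE] := sat_recognizable psi.
have rPf := recognizable_map f rP.
eexists.
  exact: (recognizable_op orb
    (recognizable_op andb rPf (recognizable_letter (F 0) ord0))
    (recognizable_op (fun b c => ~~ b && c) rPf rQ)).
move=> u i /=; rewrite QE -PE.
have -> : pos_tuple [tuple i] = [tuple val i] by exact: val_inj.
by case: (P _ _) => /=; rewrite ?orbF.
Qed.

(** * The graph of the Lindström word and the final decomposition *)

Local Open Scope classical_set_scope.

Lemma length_preserving_map (S T : Type) (f : S -> T) :
  length_preserving_hom (map f).
Proof. by split=> // [u v | a]; [rewrite map_cat | exists (f a)]. Qed.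

Section LindstromGraph.
Variables (Delta : finType) (d : Order.disp_t) (Gamma : finTBOrderType d).
Variable phi : #|Gamma|.-1.-tuple (formula Delta 1).

Definition lindstrom_word (w : seq Delta) : seq Gamma :=
  [seq lindstrom_letter phi i | i <- enum 'I_(size w)].

Lemma size_lindstrom_word w : size (lindstrom_word w) = size w.
Proof. by rewrite size_map size_enum_ord. Qed.

Lemma regular_lindstrom_graph :
  regular [set u : seq (Delta * Gamma) | unzip2 u = lindstrom_word (unzip1 u)].
Proof.
pose F n (x : Delta * Gamma) :=
  x.2 == nth Order.top (sort <=%O (enum Gamma)) n.
have [P rP PE] := find_recognizable fst phi F.
(* A word lies in the graph iff no position carries a wrong [Gamma]-letter. *)
have := recognizable_regular (recognizable_not
  (recognizable_exists (recognizable_not rP))).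
congr regular; apply/seteqP; suff PD u :
    ~~ has (fun p => ~~ P u [tuple of p :: [tuple]]) (iota 0 (size u))
    <-> unzip2 u = lindstrom_word (unzip1 u).
  by split=> u /= /PD.
have Pu (i : 'I_(size (unzip1 u))) :
    P u [tuple of val i :: [tuple]]
    = (onth (unzip2 u) i == Some (lindstrom_letter phi i)).
  have -> : [tuple of val i :: [tuple]] = [tuple val i] by exact: val_inj.
  by rewrite PE onth_map; case: onth.
rewrite -[size u](size_map fst) has_iota_exists negb_exists.
have onthE (i : 'I_(size (unzip1 u))) :
    onth (lindstrom_word (unzip1 u)) i = Some (lindstrom_letter phi i).
  by rewrite onth_map onthE (nth_map i) ?size_enum_ord //= nth_ord_enum.
split=> [/forallP Pi | uE].
  apply/eq_from_onth => n.
  have [lt_n|le_n] := ltnP n (size (unzip1 u)).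
    have := Pi (Ordinal lt_n); rewrite negbK Pu => /eqP ->.
    by rewrite -[LHS](onthE (Ordinal lt_n)).
  by rewrite !onth_default ?size_lindstrom_word // size_map -(size_map fst).
by apply/forallP => i; rewrite negbK Pu uE onthE.
Qed.

End LindstromGraph.

Theorem theorem4 (dDelta dGamma : Order.disp_t)
    (Delta : finTBOrderType dDelta) (Gamma : finTBOrderType dGamma)
    (B : set (seq Gamma)) (phi : #|Gamma|.-1.-tuple (formula Delta 1))
    (A : set (seq Delta)) (hA : A = [set w | sat_lindstrom B phi w]) :
  exists (Sigma : finType) (g : seq Sigma -> seq Gamma)
      (h : seq Sigma -> seq Delta) (D : set (seq Sigma)),
    [/\ 0 < #|Sigma|,
        length_preserving_hom g,
        length_preserving_hom h,
        regular D
      & A = h @` (D `&` g @^-1` B)].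
Proof.
exists (Delta * Gamma)%type, unzip2, unzip1.
exists [set u | unzip2 u = lindstrom_word phi (unzip1 u)].
split; try exact: length_preserving_map.
- by apply/card_gt0P; exists (Order.top, Order.top).
- exact: regular_lindstrom_graph.
rewrite hA; apply/seteqP; split=> [w Bw | _ [u [/= uE Bu] <-]]; last first.
  by rewrite /sat_lindstrom -/(lindstrom_word phi _) -uE.
have sz : size (lindstrom_word phi w) = size w := size_lindstrom_word phi w.
(* The preimage pairs [w] with its own Lindström word; as the lengths agree, both projections
   recover the components. *)
exists (zip w (lindstrom_word phi w)); last by rewrite unzip1_zip ?sz.
by split; rewrite /= unzip2_zip ?unzip1_zip ?sz.
Qed.
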